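(* Let $G$ be a $k$-regular super-$\lambda''$ graph with $k\geqslant 4$. Let $g(G)$ denote the girth of $G$ (the length of a shortest cycle). Then (i) if $g(G)\geqslant 4$ (and $k\geqslant 4$), then $\rho'(G)=k-1$; (ii) if $g(G)=3$, then $\rho'(G)\geqslant k-3$ when $k\geqslant 6$, and $\rho'(G)=2$ when $k=5$.
   Context: All graphs are finite and simple. For a connected graph $G=(V,E)$ and an integer $h\geqslant 0$, a set $F\subseteq E(G)$ is an $h$-extra edge-cut if $G-F$ is disconnected and every component of $G-F$ has more than $h$ vertices. If such a set exists, $\lambda^{(h)}(G)$ is the minimum cardinality of an $h$-extra edge-cut, and $G$ is called $\lambda^{(h)}$-connected. A $\lambda^{(h)}$-cut is an $h$-extra edge-cut of cardinality $\lambda^{(h)}(G)$. Write $\lambda'=\lambda^{(1)}$ and $\lambda''=\lambda^{(2)}$. For $X\subset V(G)$, $d_G(X)$ is the number of edges between $X$ and $V(G)\setminus X$, and $\xi_h(G)=\min\{d_G(X): X\subset V(G),\ |X|=h+1,\ G[X]\text{ connected}\}$. A $\lambda^{(h)}$-connected graph $G$ is $\lambda^{(h)}$-optimal if $\lambda^{(h)}(G)=\xi_h(G)$, and it is super-$\lambda^{(h)}$ if it is $\lambda^{(h)}$-optimal and, for every $\lambda^{(h)}$-cut $F$ of $G$, some component of $G-F$ has exactly $h+1$ vertices. Super-$\lambda'$ and super-$\lambda''$ are the cases $h=1$ and $h=2$. A disconnected graph is not super-$\lambda^{(h)}$. For a super-$\lambda'$ graph $G$, the persistence $\rho'(G)$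 is the maximum integer $m$ such that $G-F$ is still super-$\lambda'$ for every $F\subseteq E(G)$ with $|F|\leqslant m$. Any assertion about $\rho'(G)$ includes the assertion that $G$ is super-$\lambda'$. *)

(* Defs.v *)
From mathcomp Require Import all_boot.

Set Implicit Arguments.
Unset Strict Implicit.
Unset Printing Implicit Defensive.

Record sgraph := SGraph {
  vertex :> finType;
  adj : rel vertex;
  adj_sym : symmetric adj;
  adj_irr : irreflexive adj
}.

(* Edges are unordered pairs, encoded as two-element sets of vertices. *)
Definition edges (G : sgraph) : {set {set G}} :=
  [set [set p.1; p.2] | p : G * G & adj p.1 p.2].

Definition degree (G : sgraph) (x : G) : nat := #|[set y | adj x y]|.

Definition regular (G : sgraph) (k : nat) : bool :=
  [forall x : G, degree x == k].

Section DeleteEdges.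
Variables (G : sgraph) (F : {set {set G}}).

Definition del_adj : rel G := fun x y => adj x y && ([set x; y] \notin F).

Lemma del_adj_sym : symmetric del_adj.
Proof. by move=> x y; rewrite /del_adj adj_sym setUC. Qed.

Lemma del_adj_irr : irreflexive del_adj.
Proof. by move=> x; rewrite /del_adj adj_irr. Qed.

Definition del_edges : sgraph := SGraph del_adj_sym del_adj_irr.
End DeleteEdges.

Section Induced.
Variables (G : sgraph) (X : {set G}).

Definition induced_adj : rel {x : G | x \in X} := relpre val (@adj G).

Lemma induced_adj_sym : symmetric induced_adj.
Proof. by move=> x y; apply: adj_sym. Qed.

Lemma induced_adj_irr : irreflexive induced_adj.
Proof. by move=> x; apply: adj_irr. Qed.

Definition induced : sgraph := SGraph induced_adj_sym induced_adj_irr.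
End Induced.

(* The graph without vertices counts as connected; it has no h-extra
   edge-cut, so it is never super-lambda^(h). *)
Definition connected (G : sgraph) : bool :=
  [forall x : G, forall y : G, connect (@adj G) x y].

Definition components (G : sgraph) : {set {set G}} :=
  [set [set y | connect (@adj G) x y] | x : G].

Definition is_cycle (G : sgraph) (c : seq G) : bool :=
  (2 < size c) && ucycleb (@adj G) c.

Definition has_cycle (G : sgraph) (n : nat) : bool :=
  [exists c : n.-tuple G, is_cycle c].

(* A cycle has at most #|G| vertices.  The girth of a forest, conventionally
   infinite, is #|G|.+1 here; a finite nonempty k-regular graph with 2 <= k
   is not a forest. *)
Definition girth (G : sgraph) : nat :=
  find (has_cycle G) (iota 0 #|G|.+1).

Definition extra_edge_cut (h : nat) (G : sgraph) (F : {set {set G}}) : bool :=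
  [&& F \subset edges G, ~~ connected (del_edges F)
    & [forall C in components (del_edges F), h < #|C|]].

Definition lambda_connected (h : nat) (G : sgraph) : bool :=
  connected G && [exists F : {set {set G}}, extra_edge_cut h F].

(* The default #|edges G| bounds every term, so both minima below are the true
   ones as soon as they range over a nonempty family. *)
Definition lambda (h : nat) (G : sgraph) : nat :=
  \big[minn/#|edges G|]_(F : {set {set G}} | extra_edge_cut h F) #|F|.

Definition lambda_cut (h : nat) (G : sgraph) (F : {set {set G}}) : bool :=
  extra_edge_cut h F && (#|F| == lambda h G).

Definition boundary_size (G : sgraph) (X : {set G}) : nat :=
  #|[set p : G * G | [&& p.1 \in X, p.2 \notin X & adj p.1 p.2]]|.

Definition xi (h : nat) (G : sgraph) : nat :=
  \big[minn/#|edges G|]_(X : {set G} | (#|X| == h.+1) && connected (induced X))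
    boundary_size X.

Definition lambda_optimal (h : nat) (G : sgraph) : bool :=
  lambda_connected h G && (lambda h G == xi h G).

Definition super_lambda (h : nat) (G : sgraph) : bool :=
  lambda_optimal h G &&
  [forall F : {set {set G}}, lambda_cut h F ==>
     [exists C in components (del_edges F), #|C| == h.+1]].

Definition persists (G : sgraph) (m : nat) : bool :=
  [forall F : {set {set G}}, (F \subset edges G) && (#|F| <= m) ==>
     super_lambda 1 (del_edges F)].

(* Deleting all edges of a super-lambda' graph disconnects it, so every m with
   persists G m is less than #|edges G|.  The value is 0 if G is not
   super-lambda', whence the first conjunct in persistence_eq and
   persistence_ge. *)
Definition persistence (G : sgraph) : nat :=
  \max_(m < #|edges G| | persists G m) m.

Definition persistence_eq (G : sgraph) (r : nat) : Prop :=
  super_lambda 1 G /\ persistence G = r.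

Definition persistence_ge (G : sgraph) (r : nat) : Prop :=
  super_lambda 1 G /\ r <= persistence G.

(* Main.v *)
Require Import Defs.
From mathcomp Require Import all_boot zify.

Set Implicit Arguments.
Unset Strict Implicit.
Unset Printing Implicit Defensive.

(** A minimum edge cut may be taken to be a bond: the boundary of a set X such
    that X and its complement both induce connected subgraphs.  Let H = G - F
    with |F| <= m, where m = k - 1 (no triangles) or m = k - 3, so that
    xi_2(G) >= 2k - 3 + m.  Suppose X is a bond of H with at least three
    vertices on each side.  As G is super-lambda'', d_G(X) >= 2k - 3 + m, so
    d_H(X) >= 2k - 3, while any edge of H adjacent to an edge of F has boundary
    at most 2k - 3.  If d_H(X) < 2k - 2 then d_G(X) = xi_2(G), F consists of
    m edges of the boundary of X, and one side of X has three vertices; by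
    pigeonhole two adjacent vertices of this triple meet two edges of F, and
    the edge joining them has boundary at most 2k - 4 in H.  So an edge of H
    always has a smaller boundary than X, and every lambda'-cut of H isolates an
    edge.

    The bounds are sharp: deleting the k edges at a vertex disconnects G, and
    for k = 5 deleting a matching of three edges leaving a triangle T makes the
    boundary of T a lambda'-cut that isolates no edge. *)

(** * Two- and three-element sets, and minima over finite families *)

Lemma set2_inj (T : finType) (x y a b : T) :
  [set x; y] = [set a; b] -> (x = a /\ y = b) \/ (x = b /\ y = a).
Proof.
move=> E; have xE : x \in [set a; b] by rewrite -E set21.
have yE : y \in [set a; b] by rewrite -E set22.
have aE : a \in [set x; y] by rewrite E set21.
have bE : b \in [set x; y] by rewrite E set22.
move: xE yE aE bE; rewrite !inE.
by do 4 (case/orP=> /eqP ?); subst; auto.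
Qed.

Lemma cards3P (T : finType) (A : {set T}) : #|A| = 3 ->
  exists a b c, [/\ a != b, a != c, b != c & A = [set a; b; c]].
Proof.
move=> A3; have /card_gt0P[a aA] : 0 < #|A| by rewrite A3.
have : #|A :\ a| == 2 by have := cardsD1 a A; rewrite aA A3 => -[/esym/eqP].
case/cards2P=> b [c [bc E]]; exists a, b, c.
have : b \in A :\ a by rewrite E !inE eqxx.
have : c \in A :\ a by rewrite E !inE eqxx orbT.
rewrite !inE => /andP[ca _] /andP[ba _]; split=> //; try by rewrite eq_sym.
by rewrite -(setD1K aA) E setUA.
Qed.

Section BigMin.
Variables (T : finType) (n : nat) (P : pred T) (f : T -> nat).

Lemma bigminn_le x : P x -> \big[minn/n]_(y | P y) f y <= f x.
Proof.
move=> Px; have := mem_index_enum x; elim: (index_enum T) => //= y s IH.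
rewrite big_cons inE => /predU1P[<-|/IH xs]; first by rewrite Px geq_minl.
by case: (P y); rewrite // geq_min xs orbT.
Qed.

Lemma bigminn_glb m : m <= n -> (forall x, P x -> m <= f x) ->
  m <= \big[minn/n]_(y | P y) f y.
Proof.
by move=> mn mf; elim/big_rec: _ => // x y Px my; rewrite leq_min mf.
Qed.

Lemma bigminn_attained :
  \big[minn/n]_(y | P y) f y = n \/
  exists2 x, P x & \big[minn/n]_(y | P y) f y = f x.
Proof.
elim/big_rec: _ => [|x y Px IH]; first by left.
by rewrite /minn; case: ifP => _ //; right; exists x.
Qed.
End BigMin.

(** * Boundaries and degrees *)

Section Boundary.
Variable G : sgraph.
Implicit Types (x y z u v : G) (X Y : {set G}) (F : {set {set G}}).

Definition nbr x : {set G} := [set y | adj x y].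

Definition edge_boundary X : {set {set G}} :=
  [set [set p.1; p.2] | p in [set p : G * G |
    [&& p.1 \in X, p.2 \notin X & adj p.1 p.2]]].

Lemma adj_neq x y : adj x y -> x != y.
Proof. by apply: contraTneq => ->; rewrite adj_irr. Qed.

Lemma edgesP (e : {set G}) :
  reflect (exists x y, adj x y /\ e = [set x; y]) (e \in edges G).
Proof.
apply: (iffP imsetP) => [[[x y] xy ->]|[x [y [xy ->]]]].
  by exists x, y; rewrite inE in xy.
by exists (x, y); rewrite ?inE.
Qed.

Lemma mem_edges x y : ([set x; y] \in edges G) = adj x y.
Proof.
apply/edgesP/idP => [[a [b [ab]]]|xy]; last by exists x, y.
by case/set2_inj=> -[-> ->] //; rewrite adj_sym.
Qed.

Lemma edge_boundaryP X (e : {set G}) :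
  reflect (exists x y, [/\ x \in X, y \notin X, adj x y & e = [set x; y]])
          (e \in edge_boundary X).
Proof.
apply: (iffP imsetP) => [[[x y]]|[x [y [xX yX xy ->]]]].
  by rewrite inE /= => /and3P[xX yX xy] ->; exists x, y.
by exists (x, y) => //; rewrite inE /= xX yX xy.
Qed.

Lemma mem_edge_boundary X x y : adj x y ->
  ([set x; y] \in edge_boundary X) = ((x \in X) != (y \in X)).
Proof.
move=> xy; apply/edge_boundaryP/idP => [[a [b [aX /negbTE bX ab]]]|].
  by case/set2_inj=> -[-> ->]; rewrite aX bX.
case xX: (x \in X); case yX: (y \in X) => // _.
  by exists x, y; rewrite xX yX.
by exists y, x; rewrite xX yX adj_sym setUC.
Qed.

Lemma edge_boundary_sub X : edge_boundary X \subset edges G.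
Proof.
apply/subsetP=> e /edge_boundaryP[x [y [_ _ xy ->]]].
by rewrite mem_edges.
Qed.

Lemma card_edge_boundary X : #|edge_boundary X| = boundary_size X.
Proof.
rewrite card_in_imset // => -[x y] [a b]; rewrite !inE /=.
case/and3P=> xX yX _ /and3P[aX bX _] /set2_inj[] [? ?]; subst=> //.
by rewrite xX in bX.
Qed.

Lemma edge_boundaryC X : edge_boundary (~: X) = edge_boundary X.
Proof.
apply/setP=> e; apply/idP/idP=> /[dup] /(subsetP (edge_boundary_sub _)).
  case/edgesP=> x [y [xy ->]]; rewrite !mem_edge_boundary // !inE.
  by case: (x \in X); case: (y \in X).
case/edgesP=> x [y [xy ->]]; rewrite !mem_edge_boundary // !inE.
by case: (x \in X); case: (y \in X).
Qed.

Lemma boundary_sizeC X : boundary_size (~: X) = boundary_size X.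
Proof. by rewrite -!card_edge_boundary edge_boundaryC. Qed.

Lemma boundary_size_sum X : boundary_size X = \sum_(x in X) #|nbr x :\: X|.
Proof.
rewrite /boundary_size -sum1_card.
under [RHS]eq_bigr do rewrite -sum1_card.
rewrite pair_big_dep /=; apply: eq_bigl => -[x y]; rewrite !inE /=.
by case: (x \in X); case: (y \in X).
Qed.

Lemma card_nbr_sum x X : #|nbr x :&: X| = \sum_(y in X) adj x y.
Proof.
rewrite -sum1_card big_mkcond [RHS]big_mkcond; apply: eq_bigr => y _.
by rewrite !inE; case: (adj x y); case: (y \in X).
Qed.

(** The double sum counts every edge inside X twice, once from each end. *)
Lemma degree_boundary X :
  boundary_size X + \sum_(x in X) \sum_(y in X) adj x y
  = \sum_(x in X) degree x.
Proof.
rewrite boundary_size_sum -big_split /=; apply: eq_bigr => x _.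
by rewrite -card_nbr_sum addnC cardsID.
Qed.

Lemma boundary_size2 u v : adj u v ->
  boundary_size [set u; v] + 2 = degree u + degree v.
Proof.
move=> uv; have := degree_boundary [set u; v].
have /negbTE uv' := adj_neq uv.
do 4 (rewrite ?big_setU1 ?inE ?uv' //= ?big_set1).
by rewrite !adj_irr uv adj_sym uv.
Qed.

Lemma boundary_size3 (a b c : G) : a != b -> a != c -> b != c ->
  boundary_size [set a; b; c] + 2 * (adj a b + adj a c + adj b c)
  = degree a + degree b + degree c.
Proof.
move=> ab ac bc; have := degree_boundary [set a; b; c].
have E (f : G -> nat) : \sum_(x in [set a; b; c]) f x = f a + f b + f c.
  by rewrite -setUA !big_setU1 ?inE ?negb_or ?ab ?ac ?bc // big_set1 /= addnA.
rewrite !E !adj_irr (adj_sym b a) (adj_sym c a) (adj_sym c b).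
by move: (adj a b) (adj a c) (adj b c) => [] [] []; lia.
Qed.

Definition star x : {set {set G}} := [set e in edges G | x \in e].

Lemma starE x : star x = [set [set x; y] | y in nbr x].
Proof.
apply/setP=> e; rewrite inE; apply/andP/imsetP => [[/edgesP[a [b [ab ->]]]]|].
  rewrite !inE => /orP[] /eqP ?; subst; first by exists b; rewrite ?inE.
  by exists a; rewrite ?inE ?(adj_sym b) // setUC.
by case=> y; rewrite inE => xy ->; rewrite mem_edges xy set21.
Qed.

Lemma set2_injr x : injective (fun y => [set x; y]).
Proof. by move=> y z /set2_inj[] [? ?]; subst. Qed.

Lemma card_star x : #|star x| = degree x.
Proof. by rewrite starE card_imset //; apply: set2_injr. Qed.

(** Double counting of incidences: every edge of F has exactly two ends. *)
Lemma handshake F : F \subset edges G ->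
  \sum_x #|[set e in F | x \in e]| = 2 * #|F|.
Proof.
move=> FG; under eq_bigr do rewrite -sum1_card.
rewrite (exchange_big_dep (mem F)) /=; last by move=> x e _; rewrite inE => /andP[].
rewrite mulnC -sum_nat_const; apply: eq_bigr => e eF.
have /edgesP[x [y [xy exy]]] := subsetP FG e eF.
transitivity #|e|; last by rewrite exy cards2 (adj_neq xy).
by rewrite -sum1_card; apply: eq_bigl => z; rewrite inE eF.
Qed.

End Boundary.

(** * Bonds *)

Section Bond.
Variable G : sgraph.
Implicit Types (x y z u v : G) (X Y : {set G}) (F : {set {set G}}).

Lemma del_boundaryE X x y :
  del_adj (edge_boundary X) x y = adj x y && ((x \in X) == (y \in X)).
Proof.
rewrite /del_adj; case xy: (adj x y) => //=.
by rewrite mem_edge_boundary ?negbK.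
Qed.

Lemma connectedP : reflect (forall x y, connect (@adj G) x y) (connected G).
Proof.
by apply: (iffP forallP) => H x; apply/forallP.
Qed.

Lemma closed_inv (r : rel G) X x y :
  (forall u v, r u v -> (u \in X) = (v \in X)) -> connect r x y ->
  (x \in X) = (y \in X).
Proof. by move=> rX; apply: closed_connect. Qed.

Lemma exit_edge X : connected G -> X != set0 -> ~: X != set0 ->
  exists x y, [/\ x \in X, y \notin X & adj x y].
Proof.
move=> /connectedP Gc /set0Pn[x xX] /set0Pn[y]; rewrite inE => yX.
have [/existsP[u /existsP[v /and3P[? ? ?]]]|no] :=
  boolP [exists u, exists v, [&& u \in X, v \notin X & adj u v]].
  by exists u, v.
rewrite -(closed_inv _ (Gc x y)) ?xX // in yX => u v uv.
have H a b : adj a b -> a \in X -> b \in X.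
  move=> ab aX; apply: contraNT no => bX.
  by apply/existsP; exists a; apply/existsP; exists b; rewrite aX bX ab.
by apply/idP/idP; apply: H; rewrite // adj_sym.
Qed.

Lemma nonisolated x : connected G -> 1 < #|G| -> exists y, adj x y.
Proof.
move=> Gc G1; have [||y [z [/set1P-> _ xz]]] := @exit_edge [set x] Gc.
- by apply/set0Pn; exists x; rewrite inE.
- by rewrite -card_gt0 cardsC1; lia.
by exists z.
Qed.

(** Connectedness of the two sides is expressed in G minus the boundary instead of through
    [induced]: no subtype of vertices is needed, and X and its complement are directly the
    components left by the cut. *)
Definition bond X := [/\ X != set0, ~: X != set0 &
  forall x y, (x \in X) = (y \in X) ->
    connect (del_adj (edge_boundary X)) x y].

Lemma bondC X : bond X -> bond (~: X).
Proof.
case=> X0 XC0 H; split; rewrite ?setCK // => x y; rewrite !inE edge_boundaryC.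
by move/negb_inj; apply: H.
Qed.

(* Among the nontrivial unions of classes of [r], one with the smallest
   boundary is a bond: a disconnected side would split off a piece with a
   smaller boundary. *)
Lemma bond_exists (r : rel G) x0 y0 : connected G -> symmetric r ->
    (forall x y, r x y -> adj x y) -> ~~ connect r x0 y0 ->
  exists X, bond X /\ forall x y, r x y -> (x \in X) = (y \in X).
Proof.
move=> Gc r_sym rG nxy.
pose P X := [&& X != set0, ~: X != set0 &
  [forall x, forall y, r x y ==> ((x \in X) == (y \in X))]].
have PP X : P X -> [/\ X != set0, ~: X != set0 &
    forall x y, r x y -> (x \in X) = (y \in X)].
  case/and3P=> ? ? /forallP H; split=> // x y xy.
  by have /forallP/(_ y)/implyP/(_ xy)/eqP := H x.
pose X0 := [set y | connect r x0 y].
have PX0 : P X0.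
  apply/and3P; split.
  - by apply/set0Pn; exists x0; rewrite inE.
  - by apply/set0Pn; exists y0; rewrite !inE.
  apply/forallP=> x; apply/forallP=> y; apply/implyP=> xy; rewrite !inE.
  apply/eqP; apply: same_connect_r; first exact: sym_connect_sym.
  exact: connect1.
have [X /[dup] PX /PP[X0' XC0 Xr] Xmin] := arg_minnP (@boundary_size G) PX0.
have side Y : P Y -> boundary_size Y = boundary_size X ->
    forall x y, x \in Y -> y \in Y -> connect (del_adj (edge_boundary Y)) x y.
  move=> /PP[Y0 YC0 Yr] YX x y xY yY; apply/negPn/negP=> nc.
  pose e := del_adj (edge_boundary Y).
  have e_sym : connect_sym e by apply/sym_connect_sym/del_adj_sym.
  (* If y cannot be reached from x inside Y, the piece A around x is still a union of classes of
     [r]. Its boundary lies in that of Y, and strictly so: an edge leaving [Y :\: A] cannot enter A,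
     which is closed inside Y, so it leaves Y. This contradicts minimality. *)
  pose A := [set z | connect e x z].
  have AY z : z \in A -> z \in Y.
    rewrite inE => /closed_inv <- // u v; rewrite /e del_boundaryE.
    by case/andP=> _ /eqP.
  have Ae u v : adj u v -> u \in Y -> v \in Y -> (u \in A) = (v \in A).
    move=> uv uY vY; rewrite !inE; apply: same_connect_r => //.
    by apply: connect1; rewrite /e del_boundaryE uv uY vY.
  have [||s [t [sB tB st]]] := @exit_edge (Y :\: A) Gc.
  - by apply/set0Pn; exists y; rewrite !inE yY andbT.
  - by apply/set0Pn; exists x; rewrite !inE connect0.
  have PA : P A.
    apply/and3P; split.
    - by apply/set0Pn; exists x; rewrite inE connect0.
    - by apply/set0Pn; exists y; rewrite !inE.
    apply/forallP=> u; apply/forallP=> v; apply/implyP=> uv; apply/eqP.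
    have uvY := Yr _ _ uv.
    case uY: (u \in Y); first by apply: Ae; rewrite -?uvY // rG.
    by apply/idP/idP=> /AY; rewrite -?uvY uY.
  have := Xmin _ PA; rewrite -YX leqNgt => /negP[].
  apply: proper_card; apply/properP; split.
    apply/subsetP=> -[u v]; rewrite [in X in X -> _]inE [in X in _ -> X]inE /=.
    case/and3P=> uA vA uv; rewrite uv (AY _ uA) /= andbT.
    by apply: contra vA => vY; rewrite -(Ae u v) // AY.
  move: sB tB; rewrite !in_setD => /andP[sA sY].
  rewrite negb_and negbK => tAY.
  have tY : t \notin Y.
    case/orP: tAY => // tA; apply: contra sA => tY.
    by rewrite (Ae s t).
  by exists (s, t); rewrite [_ \in _]inE /= ?sY ?tY ?st // (negbTE sA).
(* Neither [P] nor the boundary size changes under complementation, so [side] also applies to the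
   other side. *)
have PXC : P (~: X).
  rewrite /P setCK X0' XC0 /=; apply/forallP=> x; apply/forallP=> y.
  by apply/implyP=> /Xr xy; rewrite !inE xy.
exists X; split=> //; split=> // x y.
case xX: (x \in X) => yX; first exact: side.
by rewrite -edge_boundaryC; apply: side; rewrite ?boundary_sizeC ?inE ?xX -?yX.
Qed.

Lemma components_extra h F :
  [forall C in components (del_edges F), h < #|C|] =
  [forall x : G, h < #|[set y | connect (del_adj F) x y]|].
Proof.
apply/forallP/forallP => [H x|H C].
  by apply: (implyP (H _)); apply/imsetP; exists x.
by apply/implyP=> /imsetP[x _ ->]; apply: H.
Qed.

Lemma bond_component X x : bond X -> x \in X ->
  [set y | connect (del_adj (edge_boundary X)) x y] = X.
Proof.
case=> _ _ H xX; apply/setP=> y; rewrite inE; apply/idP/idP=> [|yX].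
  move/closed_inv=> <- // u v; rewrite del_boundaryE.
  by case/andP=> _ /eqP.
by apply: H; rewrite xX yX.
Qed.

Lemma bond_componentC X x : bond X -> x \notin X ->
  [set y | connect (del_adj (edge_boundary X)) x y] = ~: X.
Proof.
by move=> /bondC Xb xX; rewrite -edge_boundaryC bond_component ?inE.
Qed.

Lemma boundary_disconnects X : X != set0 -> ~: X != set0 ->
  ~~ connected (del_edges (edge_boundary X)).
Proof.
move=> /set0Pn[x xX] /set0Pn[y]; rewrite inE => yX.
apply: contra yX => /forallP/(_ x)/forallP/(_ y)/= /closed_inv <- // u v.
by rewrite del_boundaryE => /andP[_ /eqP].
Qed.

Lemma bond_extra_cut h X : bond X -> h < #|X| -> h < #|~: X| ->
  extra_edge_cut h (edge_boundary X).
Proof.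
move=> Xb hX hXC; have [X0 XC0 _] := Xb.
rewrite /extra_edge_cut edge_boundary_sub boundary_disconnects //=.
rewrite components_extra; apply/forallP=> x.
case xX: (x \in X); first by rewrite bond_component.
by rewrite bond_componentC ?xX.
Qed.

(** Here the sides may be disconnected: a neighbour on its own side already gives each vertex a
    component with two vertices. *)
Lemma boundary_extra_cut1 X : X != set0 -> ~: X != set0 ->
    (forall x, exists2 y, adj x y & (x \in X) = (y \in X)) ->
  extra_edge_cut 1 (edge_boundary X).
Proof.
move=> X0 XC0 H.
rewrite /extra_edge_cut edge_boundary_sub boundary_disconnects //=.
rewrite components_extra; apply/forallP=> x; have [y xy xyX] := H x.
apply: leq_trans (subset_leq_card (_ : [set x; y] \subset _)).
  by rewrite cards2 (adj_neq xy).
apply/subsetP=> z /set2P[]->; rewrite inE ?connect0 //.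
by apply: connect1; rewrite del_boundaryE xy xyX eqxx.
Qed.

(** For the relation of G - F, each side of the bond from [bond_exists] is a union of components of
    G - F, hence at least as large as one of them. *)
Lemma extra_cut_bond h F : connected G -> extra_edge_cut h F ->
  exists X, [/\ bond X, edge_boundary X \subset F, h < #|X| & h < #|~: X|].
Proof.
move=> Gc /and3P[FG nc]; rewrite components_extra => /forallP big.
have : exists x y, ~~ connect (del_adj F) x y.
  case/forallPn: nc => x /forallPn[y nxy].
  by exists x, y.
case=> x [y nxy].
have [||X [Xb Xcl]] := bond_exists Gc _ _ nxy; first exact: del_adj_sym.
  by move=> u v /andP[].
have large Y z : (forall u v, del_adj F u v -> (u \in Y) = (v \in Y)) ->
    z \in Y -> h < #|Y|.
  move=> Ycl zY; apply: leq_trans (big z) (subset_leq_card _).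
  by apply/subsetP=> t; rewrite inE => /closed_inv <-.
exists X; have [/set0Pn[a aX] /set0Pn[b bX] _] := Xb; split=> //.
- apply/subsetP=> e /edge_boundaryP[u [v [uX vX uv ->]]].
  apply: contraNT vX => nF; rewrite -(Xcl u v) //.
  by rewrite /del_adj uv.
- exact: large aX.
by apply: large bX => u v uv; rewrite !inE (Xcl _ _ uv).
Qed.

Lemma bond2 X : bond X -> #|X| = 2 -> exists u v, adj u v /\ X = [set u; v].
Proof.
move=> Xb X2; have /eqP/cards2P[u [v [uv XE]]] := X2.
exists u, v; split=> //; apply/negPn/negP=> nuv.
have uX : u \in X by rewrite XE set21.
have : v \in [set y | connect (del_adj (edge_boundary X)) u y].
  by rewrite bond_component // XE set22.
rewrite inE => /closed_inv H.
(* If u and v were not adjacent, {u} would be closed under the edges that remain. *)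
suff cl a b : del_adj (edge_boundary X) a b -> (a \in [set u]) = (b \in [set u]).
  by have := H _ cl; rewrite !inE eqxx eq_sym (negbTE uv).
rewrite del_boundaryE !inE XE !inE => /andP[].
case: (eqVneq a u) => [->|_]; case: (eqVneq b u) => [->|_] //= uv1 /eqP.
  by move/esym/eqP=> bv; rewrite -bv uv1 in nuv.
by move/eqP=> av; rewrite -av adj_sym uv1 in nuv.
Qed.

End Bond.

(** * A criterion for super-lambda' *)

Section Criterion.
Variable G : sgraph.
Implicit Types (x y z u v : G) (X Y : {set G}) (F : {set {set G}}).

Lemma boundary_size_edges X : boundary_size X <= #|edges G|.
Proof.
by rewrite -card_edge_boundary; apply/subset_leq_card/edge_boundary_sub.
Qed.

Lemma connected_induced2 u v : adj u v -> connected (induced [set u; v]).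
Proof.
move=> uv; apply/connectedP=> x y.
have [->|] := eqVneq x y; first exact: connect0.
case: x y => [x xX] [y yX]; rewrite -val_eqE => /= xy.
apply: connect1; rewrite /= /induced_adj /=.
by case/set2P: xX yX xy => -> /set2P[]->; rewrite ?eqxx // adj_sym.
Qed.

Lemma induced2_adj u v : u != v -> connected (induced [set u; v]) -> adj u v.
Proof.
move=> uv /connectedP H.
have /connectP[[|w p] /=] := H (exist _ u (set21 u v)) (exist _ v (set22 u v)).
  by move=> _ [vu]; rewrite vu eqxx in uv.
case/andP; rewrite /induced_adj /= => uw _ _.
by have /set2P[] := valP w => wE; move: uw; rewrite /= wE // adj_irr.
Qed.

Lemma xi1_le u v : adj u v -> xi 1 G <= boundary_size [set u; v].
Proof.
move=> uv; apply: bigminn_le.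
by rewrite cards2 (adj_neq uv) connected_induced2.
Qed.

Lemma xi1_attained x y : adj x y ->
  exists u v, adj u v /\ boundary_size [set u; v] <= xi 1 G.
Proof.
move=> xy; rewrite /xi.
set P := (X in \big[_/_]_(i | X i) _); set f := (X in \big[_/_]_(i | _) X i).
have [->|[X /andP[/cards2P[u [v [uv XE]]] Xc] ->]] := bigminn_attained #|edges G| P f.
  by exists x, y; split=> //; apply: boundary_size_edges.
by exists u, v; rewrite /f XE; split=> //; apply: induced2_adj; rewrite -?XE.
Qed.

Lemma lambda_le h F : extra_edge_cut h F -> lambda h G <= #|F|.
Proof. exact: bigminn_le. Qed.

(** By [big], a bond with at least two vertices on each side and a boundary of size at most xi_1 has
    a side with exactly two vertices; this gives the lower bound on lambda' and the shape of its
    cuts. The hypothesis [indep] serves to produce a 1-extra edge-cut of size at most xi_1. *)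
Lemma super_lambda1P x0 y0 : connected G -> adj x0 y0 ->
    (forall X, bond X -> 2 < #|X| -> 2 < #|~: X| ->
       exists u v, adj u v /\ boundary_size [set u; v] < boundary_size X) ->
    (forall u v, adj u v -> exists w z,
       [/\ adj w z, w \notin [set u; v] & z \notin [set u; v]]) ->
  super_lambda 1 G.
Proof.
move=> Gc xy0 big indep.
(* Each 1-extra edge-cut contains the boundary of a bond; if it has at most xi_1 edges, the two
   coincide. *)
have lower F : extra_edge_cut 1 F -> xi 1 G <= #|F| /\
    (#|F| <= xi 1 G -> exists X, [/\ bond X, F = edge_boundary X &
      #|X| = 2 \/ #|~: X| = 2]).
  case/(extra_cut_bond Gc)=> X [Xb XF X1 XC1].
  have XFc := subset_leq_card XF; have Xd := card_edge_boundary X.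
  have two Y : bond Y -> #|Y| = 2 -> xi 1 G <= boundary_size Y.
    by move=> Yb /(bond2 Yb)[u [v [uv ->]]]; apply: xi1_le.
  have [X2|X2] : #|X| = 2 \/ #|~: X| = 2 \/ 2 < #|X| /\ 2 < #|~: X| by lia.
    have le := two _ Xb X2; split=> [|ge]; first by lia.
    exists X; split; auto.
    by apply/esym/eqP; rewrite eqEcard XF; lia.
  case: X2 => [X2|[X2 XC2]].
    have le := two _ (bondC Xb) X2; rewrite boundary_sizeC in le.
    split=> [|ge]; first by lia.
    exists X; split; auto.
    by apply/esym/eqP; rewrite eqEcard XF; lia.
  have [u [v [uv lt]]] := big X Xb X2 XC2.
  by have := xi1_le uv; split; lia.
have [u [v [uv uvx]]] := xi1_attained xy0.
have [w [z [wz wuv zuv]]] := indep u v uv.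
(* The boundary of the optimal pair {u, v} need not be 1-extra, as removing the pair may isolate
   other vertices. Instead D is the component of the edge wz after this removal; its boundary lies
   in that of the pair, and the isolated vertices stay on the side of u and v, to one of which they
   are adjacent. *)
pose D := [set y | connect (del_adj (edge_boundary [set u; v])) w y].
have Dout t : t \in D -> t \notin [set u; v].
  rewrite inE => /closed_inv <- // a b.
  by rewrite del_boundaryE => /andP[_ /eqP].
have Dadj s t : s \notin [set u; v] -> t \notin [set u; v] -> adj s t ->
    (s \in D) = (t \in D).
  move=> suv tuv st; rewrite !inE; apply: same_connect_r.
    exact/sym_connect_sym/del_adj_sym.
  by apply: connect1; rewrite del_boundaryE st (negbTE suv) (negbTE tuv).
have wD : w \in D by rewrite inE connect0.
have uD : u \notin D by apply/negP=> /Dout; rewrite set21.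
have vD : v \notin D by apply/negP=> /Dout; rewrite set22.
have Dcut : extra_edge_cut 1 (edge_boundary D).
  apply: boundary_extra_cut1.
  - by apply/set0Pn; exists w.
  - by apply/set0Pn; exists u; rewrite inE.
  move=> x; have [/set2P[]->|xuv] := boolP (x \in [set u; v]).
  - by exists v; rewrite // (negbTE uD) (negbTE vD).
  - by exists u; rewrite 1?adj_sym // (negbTE uD) (negbTE vD).
  have [|y xy] := @nonisolated _ x Gc.
    by apply/card_gt1P; exists u, v; rewrite adj_neq.
  have [yuv|yuv] := boolP (y \in [set u; v]); last by exists y => //; apply: Dadj.
  have [xD|xD] := boolP (x \in D).
    have zD : z \in D by rewrite -(Dadj w).
    have [->|xw] := eqVneq x w; first by exists z; rewrite ?zD.
    have : connect (del_adj (edge_boundary [set u; v])) x w.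
      by move: xD; rewrite inE (sym_connect_sym (@del_adj_sym _ _)).
    case/connectP=> -[/= _ wx|t p /= /andP[xt _] _].
      by rewrite wx eqxx in xw.
    move: xt; rewrite del_boundaryE (negbTE xuv) => /andP[xt /eqP tuv].
    by exists t; rewrite // -(Dadj x) ?xD // -tuv.
  exists y => //; apply/esym/negbTE/negP=> /Dout; by rewrite yuv.
have Ddb : boundary_size D <= boundary_size [set u; v].
  rewrite -!card_edge_boundary; apply/subset_leq_card/subsetP=> e.
  case/edge_boundaryP=> s [t [sD tD st ->]]; rewrite mem_edge_boundary //.
  rewrite (negbTE (Dout _ sD)); apply: contraNneq tD => tuv.
  by rewrite -(Dadj s) // ?(Dout _ sD) // -tuv.
have le_lx := leq_trans (lambda_le Dcut) (_ : _ <= xi 1 G).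
have le_xl : xi 1 G <= lambda 1 G.
  apply: bigminn_glb => [|F /lower[] //].
  exact: leq_trans (xi1_le xy0) (boundary_size_edges _).
have xl : lambda 1 G = xi 1 G.
  by apply/eqP; rewrite eqn_leq le_xl le_lx // card_edge_boundary; lia.
apply/andP; split.
  rewrite /lambda_optimal /lambda_connected Gc xl eqxx andbT.
  by apply/existsP; exists (edge_boundary D).
apply/forallP=> F; apply/implyP=> /andP[/lower[_ H] /eqP FE].
have [|X [Xb -> X2]] := H; first by rewrite FE xl.
have [/set0Pn[a aX] /set0Pn[b bX] _] := Xb.
apply/existsP; case: X2 => X2.
  exists X; rewrite X2 eqxx andbT; apply/imsetP; exists a => //.
  by rewrite /= bond_component.
exists (~: X); rewrite X2 eqxx andbT; apply/imsetP; exists b => //.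
by rewrite /= bond_componentC //; rewrite inE in bX.
Qed.


End Criterion.

(** * Deleting edges from a regular super-lambda'' graph *)

Section SuperLambda.
Variables (G : sgraph) (h : nat).
Hypothesis sup : super_lambda h G.

Lemma super_connected : connected G.
Proof. by case/andP: sup => /andP[/andP[]]. Qed.

Lemma super_bond : exists X : {set G}, [/\ bond X, h < #|X| & h < #|~: X|].
Proof.
case/andP: sup => /andP[/andP[Gc /existsP[F Fcut]] _] _.
by have [X [Xb _ X1 X2]] := extra_cut_bond Gc Fcut; exists X.
Qed.

Lemma super_card : 2 * h.+1 <= #|G|.
Proof.
by have [X [_ X1 X2]] := super_bond; rewrite -(cardsC X); lia.
Qed.

Lemma super_xi_le (X : {set G}) : bond X -> h < #|X| -> h < #|~: X| ->
  xi h G <= boundary_size X.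
Proof.
move=> Xb X1 X2; case/andP: sup => /andP[_ /eqP<-] _.
by rewrite -card_edge_boundary; apply/lambda_le/bond_extra_cut.
Qed.

Lemma super_xi_eq (X : {set G}) : bond X -> h < #|X| -> h < #|~: X| ->
  boundary_size X = xi h G -> #|X| = h.+1 \/ #|~: X| = h.+1.
Proof.
move=> Xb X1 X2 dX; case/andP: sup => /andP[_ /eqP lx] /forallP.
move/(_ (edge_boundary X))/implyP; rewrite /lambda_cut bond_extra_cut //=.
rewrite card_edge_boundary dX lx eqxx => /(_ isT)/existsP[C /andP[]].
case/imsetP=> x _ -> /eqP; case xX: (x \in X).
  by rewrite /= bond_component //; left.
by rewrite /= bond_componentC ?xX //; right.
Qed.

End SuperLambda.

(** * A lower bound on xi_2 in regular graphs *)

Section Regular.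
Variables (G : sgraph) (k : nat).
Hypothesis reg : regular G k.

Lemma regular_degree (x : G) : degree x = k.
Proof. exact/eqP/(forallP reg). Qed.

Lemma regular_edges : k * #|G| = 2 * #|edges G|.
Proof.
rewrite -handshake // (eq_bigr (fun=> k)) => [|x _]; last first.
  by rewrite -[LHS]/#|star x| card_star regular_degree.
by rewrite sum_nat_const mulnC.
Qed.

(** The parameter t bounds the number of edges inside a triple: t = 2 without triangles gives 2k - 3
    + (k - 1), and t = 3 in general gives 2k - 3 + (k - 3). *)
Lemma regular_xi2_ge t : 4 <= k -> 6 <= #|G| -> t <= 3 ->
    (forall a b c : G, a != b -> a != c -> b != c ->
       adj a b + adj a c + adj b c <= t) ->
  3 * k - 2 * t <= xi 2 G.
Proof.
move=> k4 G6 t3 few; apply: bigminn_glb => [|X /andP[/eqP X3 _]].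
  (* The default value of the minimum is k |G| / 2, which is at least 3k. *)
  by have := regular_edges; nia.
have [a [b [c [ab ac bc ->]]]] := cards3P X3.
have := boundary_size3 ab ac bc; rewrite !regular_degree.
by have := few _ _ _ ab ac bc; lia.
Qed.

End Regular.

(** The pigeonhole argument for a triple whose vertices meet p, q and r deleted edges. The degree
    count leaves two adjacent pairs if m = k - 1 and three if m = k - 3. Over these pairs the sums
    add up to at least 3 in the first case and to at least 2m >= 4 in the second, so one pair
    receives 2. *)
Lemma heavy_pair k m p q r (ab ac bc : bool) : 4 <= k ->
    m = k - 1 \/ m = k - 3 /\ 5 <= k -> m <= p + q + r ->
    2 * k - 3 + m + 2 * (ab + ac + bc) = k + k + k ->
  [|| ab && (2 <= p + q), ac && (2 <= p + r) | bc && (2 <= q + r)].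
Proof. by case: ab; case: ac; case: bc => /=; lia. Qed.

(** * The graph H = G - F *)

Section DeletedEdges.
Variables (G : sgraph) (k m : nat) (F : {set {set G}}).
Variables (e : rel G) (e_sym : symmetric e) (e_irr : irreflexive e).
(* Agreement of [e] with [del_adj F] is only required pointwise, so that the
   section applies to [G] itself (with [F = set0]), which is not convertible
   to [del_edges set0]. *)
Hypotheses (eE : e =2 del_adj F) (FG : F \subset edges G) (Fm : #|F| <= m).
Hypotheses (k4 : 4 <= k) (reg : regular G k) (sup : super_lambda 2 G).
Hypothesis xi_ge : 2 * k - 3 + m <= xi 2 G.
Hypothesis m_eq : m = k - 1 \/ m = k - 3 /\ 5 <= k.

Let H := SGraph e_sym e_irr.

Let Gc := super_connected sup.

Let G6 : 6 <= #|G|. Proof. exact: super_card sup. Qed.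

Let HG (x y : G) : @adj H x y -> adj x y.
Proof. by rewrite /= eE => /andP[]. Qed.

Let boundaryE (X : {set G}) : @edge_boundary H X = edge_boundary X :\: F.
Proof.
apply/setP=> f; rewrite in_setD; apply/idP/idP.
  case/(@edge_boundaryP H)=> x [y [xX yX xy ->]].
  move: xy; rewrite /= eE => /andP[xy ->] /=.
  by apply/(@edge_boundaryP G); exists x, y.
case/andP=> nF /(@edge_boundaryP G)[x [y [xX yX xy fE]]].
apply/(@edge_boundaryP H); exists x, y; split=> //.
by rewrite /= eE /del_adj xy -fE.
Qed.

Let sizeH (X : {set G}) : nat := @boundary_size H X.

Let sizeE (X : {set G}) :
  sizeH X + #|edge_boundary X :&: F| = boundary_size X.
Proof.
by rewrite /sizeH -!card_edge_boundary boundaryE addnC cardsID.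
Qed.

Let deg := regular_degree reg.

Let bondHG (X : {set G}) : @bond H X -> @bond G X.
Proof.
case=> X0 XC0 c; split=> // x y /c; apply: connect_sub => u v.
rewrite !del_boundaryE => /andP[uv uvX]; apply: connect1.
by rewrite del_boundaryE uvX HG.
Qed.

(** Otherwise G has a bond whose boundary lies in F. But a side with one or two vertices has
    boundary k or 2k - 2, and two larger sides have boundary at least xi_2; all of these exceed
    m. *)
Let Hc : connected H.
Proof.
apply/connectedP=> x y; apply/negPn/negP=> nxy.
have [X [Xb Xcl]] := bond_exists Gc e_sym HG nxy.
have Xm : boundary_size X <= m.
  apply: leq_trans Fm; rewrite -card_edge_boundary.
  apply/subset_leq_card/subsetP=> f /edge_boundaryP[u [v [uX vX uv ->]]].
  apply: contraNT vX => nF; rewrite -(Xcl u) // eE.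
  by rewrite /del_adj uv.
have small (Y : {set G}) : bond Y -> boundary_size Y <= m -> #|Y| <= 2 -> False.
  move=> Yb Ym Y2; have [Y0 _ _] := Yb; rewrite -card_gt0 in Y0.
  have [Y1|{}Y2] : #|Y| = 1 \/ #|Y| = 2 by lia.
    move: Ym (degree_boundary Y); have /eqP/cards1P[a ->] := Y1.
    by rewrite !big_set1 adj_irr deg /=; lia.
  have [u [v [uv YE]]] := bond2 Yb Y2.
  by have := boundary_size2 uv; rewrite -YE !deg; lia.
case: (leqP #|X| 2) => X2; first exact: small X2.
case: (leqP #|~: X| 2) => XC2.
  by apply: small XC2; rewrite ?boundary_sizeC //; apply: bondC.
by have := super_xi_le sup Xb X2 XC2; lia.
Qed.

Let size2E (u v : G) : adj u v ->
  sizeH [set u; v] + #|edge_boundary [set u; v] :&: F| + 2 = 2 * k.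
Proof. by move=> uv; rewrite sizeE boundary_size2 // !deg; lia. Qed.

Let fibre (x : G) := #|[set f in F | x \in f]|.

(** Each edge of F has exactly one end in X. So uv survives, no edge of F meets both u and v, and
    those meeting one of them cross the boundary of the pair. *)
Let fibre_pair (X : {set G}) (u v : G) : F \subset edge_boundary X ->
    u \in X -> v \in X -> adj u v ->
  @adj H u v /\ fibre u + fibre v <= #|edge_boundary [set u; v] :&: F|.
Proof.
move=> FX uX vX uv; split.
  rewrite /= eE /del_adj uv; apply/negP=> /(subsetP FX).
  by rewrite mem_edge_boundary // uX vX.
have one f : f \in F -> u \in f -> v \notin f.
  case/(subsetP FX)/edge_boundaryP=> x [y [xX yX xy ->]].
  case/set2P=> ?; subst; last by rewrite uX in yX.
  apply/negP=> /set2P[?|?]; subst; first by rewrite adj_irr in uv.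
  by rewrite vX in yX.
rewrite -cardsUI [X in _ + X](_ : _ = 0); last first.
  apply/eqP; rewrite cards_eq0; apply/eqP/setP=> f; rewrite !inE.
  by apply/negP=> /andP[/andP[fF /(one f fF)/negbTE->]]; rewrite andbF.
rewrite addn0; apply/subset_leq_card/subsetP=> f.
rewrite !in_setU !in_setI !in_set => fuv.
have fF : f \in F by case/orP: fuv => /andP[].
rewrite fF andbT; rewrite fF /= in fuv.
have /edge_boundaryP[x [y [xX yX xy fE]]] := subsetP FX f fF.
have yuv : y \notin [set u; v] by apply: contra yX => /set2P[]->.
rewrite fE mem_edge_boundary // (negbTE yuv) eqbF_neg negbK.
by case/orP: fuv; rewrite fE => /set2P[] E;
  rewrite -?E ?set21 ?set22 //; rewrite -E ?uX ?vX in yX.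
Qed.


Let cut_large (X : {set G}) : @bond H X -> 2 < #|X| -> 2 < #|~: X| ->
  exists u v : G, @adj H u v /\ sizeH [set u; v] < sizeH X.
Proof.
move=> XbH X2 XC2; have Xb := bondHG XbH.
have dX := super_xi_le sup Xb X2 XC2.
have HX := sizeE X.
have [x0 x0X] : exists x, x \in X by apply/set0Pn; case: Xb.
have H1 : 1 < #|H| by apply: leq_trans G6.
have [y0 xy0] : exists y : G, @adj H x0 y by apply: (@nonisolated H x0 Hc H1).
(* If F is empty, every edge has boundary 2k - 2, which is below 2k - 3 + m because m >= 2. *)
have [F0|/set0Pn[f fF]] := eqVneq F set0.
  exists x0, y0; split=> //.
  have := size2E (HG xy0); move: HX.
  by rewrite F0 !setI0 cards0; lia.
(* For an edge ab of F and a neighbour c of a in H, the deleted edge ab lies in the boundary of {a,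
   c}. *)
have [[u v] /= [uv duv]] : exists p : G * G, @adj H p.1 p.2 /\
    sizeH [set p.1; p.2] + 3 <= 2 * k.
  have /edgesP[a [b [ab fE]]] := subsetP FG f fF.
  have [c ac] : exists c : G, @adj H a c by apply: (@nonisolated H a Hc H1).
  exists (a, c); split=> //=; have := size2E (HG ac).
  suff : 0 < #|edge_boundary [set a; c] :&: F| by clear; lia.
  apply/card_gt0P; exists f; rewrite in_setI fF andbT fE.
  have bc : b != c.
    by apply: contraTneq ac => <-; rewrite /= eE /del_adj -fE fF andbF.
  rewrite mem_edge_boundary // !inE eqxx (eq_sym b a).
  by rewrite (negbTE (adj_neq ab)) (negbTE bc).
have [small|large] := ltnP (sizeH X) (2 * k - 2); last first.
  exists u, v; split=> //; move: duv large; clear -k4; lia.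
(* From d_G(X) >= 2k - 3 + m and d_H(X) <= 2k - 3, at least m boundary edges are deleted, which is
   all of F; then both inequalities are equalities. *)
have FX : F \subset edge_boundary X.
  have le : m <= #|edge_boundary X :&: F|.
    by move: small HX dX; clear -xi_ge; lia.
  by apply/setIidPr/eqP; rewrite eqEcard subsetIr (leq_trans Fm le).
rewrite (setIidPr FX) in HX.
have [dXe xiE Fe] : [/\ boundary_size X = xi 2 G, xi 2 G = 2 * k - 3 + m & #|F| = m].
  by move: HX small dX; clear -Fm xi_ge; split; lia.
have : exists Y : {set G}, [/\ #|Y| = 3, F \subset edge_boundary Y,
    boundary_size Y = boundary_size X &
    sizeH Y = sizeH X].
  case: (super_xi_eq sup Xb X2 XC2 dXe) => X3; first by exists X.
  by exists (~: X); rewrite edge_boundaryC boundary_sizeC /sizeH (@boundary_sizeC H).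
case=> Y [/cards3P[a [b [c [ab ac bc YE]]]] FY dY dHY].
have aY : a \in Y by rewrite YE !inE eqxx.
have bY : b \in Y by rewrite YE !inE eqxx orbT.
have cY : c \in Y by rewrite YE !inE eqxx orbT.
have cover : m <= fibre a + fibre b + fibre c.
  rewrite -Fe; apply: leq_trans (leq_trans (leq_card_setU _ _)
    (leq_add (leq_card_setU _ _) (leqnn _))).
  apply/subset_leq_card/subsetP=> g gF; rewrite !in_setU !in_set gF /=.
  have /edge_boundaryP[x [y [xY _ _ gE]]] := subsetP FY g gF.
  move: xY; rewrite YE !inE => /orP[/orP[]|] /eqP xE;
  by rewrite gE -xE set21 ?orbT.
(* The boundary of {x, y} in H is at most 2k - 4, while that of X is 2k - 3. *)
have pair x y : x \in Y -> y \in Y -> adj x y -> 2 <= fibre x + fibre y ->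
    exists u v : G, @adj H u v /\ sizeH [set u; v] < sizeH X.
  move=> xY yY xy f2; have [xyH fxy] := fibre_pair FY xY yY xy.
  exists x, y; split=> //; have := size2E xy.
  by move: HX dXe xiE Fe fxy f2; clear -k4; lia.
have dd := boundary_size3 ab ac bc; rewrite -YE !deg dY dXe xiE in dd.
case/or3P: (heavy_pair k4 m_eq cover dd) => /andP[adj2 f2].
- exact: pair aY bY adj2 f2.
- exact: pair aY cY adj2 f2.
- exact: pair bY cY adj2 f2.
Qed.

(** If every edge of G avoiding u and v were deleted, each of the other |G| - 2 >= 4 vertices would
    meet at least k - 2 edges of F. Then 4(k - 2) <= 2|F| <= 2(k - 1), which fails for k >= 4. *)
Let outside_edge (u v : G) : @adj H u v -> exists w z : G,
  [/\ @adj H w z, w \notin [set u; v] & z \notin [set u; v]].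
Proof.
move=> uv.
have [/existsP[w /existsP[z /and3P[]]]|no] := boolP [exists w : G,
  exists z : G, [&& @adj H w z, w \notin [set u; v] & z \notin [set u; v]]].
  by exists w, z.
have inF w z : adj w z -> w \notin [set u; v] -> z \notin [set u; v] ->
    [set w; z] \in F.
  move=> wz wuv zuv; apply: contraNT no => nF.
  apply/existsP; exists w; apply/existsP; exists z.
  by rewrite wuv zuv /= eE /del_adj wz nF.
have fibre_ge w : w \notin [set u; v] -> k - 2 <= fibre w.
  move=> wuv; have nw : k - 2 <= #|nbr w :\: [set u; v]|.
    have := cardsID [set u; v] (nbr w); rewrite -[#|nbr w|]/(degree w) deg.
    have := subset_leq_card (subsetIr (nbr w) [set u; v]).
    by rewrite cards2; clear; lia.
  apply: leq_trans nw _; rewrite -(card_imset _ (@set2_injr G w)).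
  apply/subset_leq_card/subsetP=> f /imsetP[z /setDP[wz zuv] ->].
  by rewrite inE in wz; apply/setIdP; split; [apply: inF | apply: set21].
have hs := handshake FG.
have : (k - 2) * (#|G| - 2) <= 2 * #|F|.
  have -> : #|G| - 2 = #|~: [set u; v]|.
    by rewrite cardsCs setCK cards2 (adj_neq (HG uv)).
  rewrite -hs mulnC -sum_nat_const [leqRHS](bigID (mem (~: [set u; v]))) /=.
  apply: leq_trans (leq_addr _ _); apply: leq_sum => w.
  by rewrite inE; apply: fibre_ge.
by move: Fm G6; clear -k4 m_eq; nia.
Qed.

Lemma del_super : super_lambda 1 H.
Proof.
have /card_gt0P[x _] : 0 < #|G| by apply: leq_trans G6.
have H1 : 1 < #|H| by apply: leq_trans G6.
have [y xy] := @nonisolated H x Hc H1.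
exact: (super_lambda1P Hc xy cut_large outside_edge).
Qed.

End DeletedEdges.

(** * Persistence *)

Lemma has_cycle3P (G : sgraph) :
  reflect (exists a b c : G, [/\ adj a b, adj a c & adj b c]) (has_cycle G 3).
Proof.
apply: (iffP existsP) => [[[[|a [|b [|c [|d s]]]] // sz]]|[a [b [c [ab ac bc]]]]].
  rewrite /is_cycle /ucycleb /= => /andP[/and4P[ab bc ca _] _].
  by exists a, b, c; split; rewrite // adj_sym.
exists [tuple a; b; c]; rewrite /is_cycle /ucycleb /= ab bc (adj_sym c a) ac.
by rewrite !inE negb_or !adj_neq.
Qed.

Lemma girth_gt3 (G : sgraph) (a b c : G) : 3 <= #|G| -> 4 <= girth G ->
  adj a b + adj a c + adj b c <= 2.
Proof.
(* Indices of [iota] are cycle lengths, and [3 <= #|G|] puts the length 3 within its range. *)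
move=> G3 /(before_find 0); rewrite nth_iota //= add0n => /has_cycle3P no.
case ab: (adj a b); case ac: (adj a c); case bc: (adj b c) => //.
by case: no; exists a, b, c.
Qed.

Lemma girth3_triangle (G : sgraph) : 3 <= #|G| -> girth G = 3 ->
  exists a b c : G, [/\ adj a b, adj a c & adj b c].
Proof.
move=> G3 g3; apply/has_cycle3P.
have hc : has (has_cycle G) (iota 0 #|G|.+1).
  by rewrite has_find size_iota -/(girth G) g3; lia.
by have := nth_find 0 hc; rewrite -/(girth G) g3 nth_iota.
Qed.

Lemma persistence_max (G : sgraph) m :
  m < #|edges G| -> persists G m -> m <= persistence G.
Proof.
move=> mE pm.
exact: (@leq_bigmax_cond _ (fun i : 'I_#|edges G| => persists G i) _ (Ordinal mE)).
Qed.

Lemma persistence_le (G : sgraph) r :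
  (forall m, persists G m -> m <= r) -> persistence G <= r.
Proof. by move=> H; apply/bigmax_leqP=> i /H. Qed.

Lemma degree_del (G : sgraph) (F : {set {set G}}) (x : G) :
  @degree (del_edges F) x + #|[set y in nbr x | [set x; y] \in F]| = degree x.
Proof.
have := cardsID [set y | [set x; y] \in F] (nbr x).
rewrite -[#|nbr x|]/(degree x) => <-; rewrite [RHS]addnC.
congr (_ + _); apply: eq_card => y; last by rewrite in_setI !in_set.
by rewrite in_setD !in_set andbC.
Qed.

(* Every edge has boundary at least 4 + 4 - 2 = 6, which is also the size of the
   boundary of the triangle; if that cut left a component with two vertices,
   the triangle and that component would be the whole graph. *)
Lemma triangle_not_super (G : sgraph) (a b c : G) : 6 <= #|G| ->
    (forall x : G, 4 <= degree x) -> adj a b -> adj a c -> adj b c ->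
    degree a = 4 -> degree b = 4 -> degree c = 4 ->
  ~~ super_lambda 1 G.
Proof.
move=> G6 deg4 ab ac bc da db dc; apply/negP=> sup.
have Gc := super_connected sup.
have [nab nac nbc] : [/\ a != b, a != c & b != c] by rewrite !adj_neq.
pose T := [set a; b; c].
have T3 : #|T| = 3 by rewrite /T -setUA cardsU1 cards2 !inE negb_or nab nac nbc.
have degT t : t \in T -> degree t = 4.
  by rewrite !inE => /orP[/orP[]|] /eqP->.
have adjT x y : x \in T -> y \in T -> x != y -> adj x y.
  rewrite !inE => /orP[/orP[]|] /eqP-> /orP[/orP[]|] /eqP->;
  by rewrite ?eqxx // adj_sym.
have dT : boundary_size T = 6.
  by have := boundary_size3 nab nac nbc; rewrite da db dc ab ac bc -/T; lia.
have cutT : extra_edge_cut 1 (edge_boundary T).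
  apply: boundary_extra_cut1.
  - by rewrite -card_gt0 T3.
  - by rewrite -card_gt0; have := cardsC T; lia.
  move=> x; case xT: (x \in T).
    have /subsetPn[y yT xy] : ~~ (T \subset [set x]).
      by apply/negP=> /subset_leq_card; rewrite T3 cards1.
    by exists y; rewrite ?yT // adjT // eq_sym -in_set1.
  have /subsetPn[y xy yT] : ~~ (nbr x \subset T).
    apply/negP=> /subset_leq_card; rewrite T3 -[#|nbr x|]/(degree x).
    by have := deg4 x; lia.
  by exists y; [rewrite inE in xy | rewrite (negbTE yT)].
have xi6 : 6 <= xi 1 G.
  have [u [v [uv le]]] := xi1_attained ab.
  by have := boundary_size2 uv; have := deg4 u; have := deg4 v; lia.
case/andP: (sup) => /andP[_ /eqP lx] /forallP/(_ (edge_boundary T))/implyP.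
have Tl := lambda_le cutT; rewrite card_edge_boundary dT in Tl.
rewrite /lambda_cut cutT card_edge_boundary dT /= eqn_leq Tl lx xi6.
case/(_ isT)/existsP=> C /andP[/imsetP[x _ CE] /eqP C2].
have Cadj w y : w \in C -> adj w y -> (y \in T) = (w \in T) -> y \in C.
  rewrite CE in_set => xw wy wyT; rewrite in_set; apply: connect_trans xw _.
  by apply: connect1; rewrite /= del_boundaryE wy wyT eqxx.
(* A component meeting the triangle would contain all three of its vertices. *)
have CT w : w \in C -> w \notin T.
  move=> wC; apply/negP=> wT.
  suff /subset_leq_card : T \subset C by rewrite T3 C2.
  apply/subsetP=> t tT; have [->//|tw] := eqVneq t w.
  by apply: (Cadj w); rewrite ?wT ?tT // adjT // eq_sym.
(* The vertex w has at least four neighbours, all among the three of T and the other vertex of C, so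
   it is adjacent to each of these. *)
have CTadj w t : w \in C -> t \in T -> adj w t.
  move=> wC tT.
  have sub : nbr w \subset T :|: (C :\ w).
    apply/subsetP=> y; rewrite inE => wy; rewrite in_setU.
    case yT: (y \in T) => //=; rewrite in_setD1 eq_sym adj_neq //=.
    by apply: (Cadj w y) => //; rewrite yT (negbTE (CT w wC)).
  have : T :|: (C :\ w) \subset nbr w.
    rewrite -(geq_leqif (subset_leqif_card sub)).
    have := cardsD1 w C; rewrite wC C2 => C1.
    have [+ _] := leq_card_setU T (C :\ w); rewrite T3.
    by rewrite -[#|nbr w|]/(degree w); move: (deg4 w) C1; clear; lia.
  by move/subsetP/(_ t); rewrite in_setU tT [_ \in nbr w]inE => /(_ isT).
(* The two vertices of C and the two others of T exhaust the degree 4 of t. *)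
have Tnbr t : t \in T -> nbr t = C :|: (T :\ t).
  move=> tT; apply/esym/eqP; rewrite eqEcard; apply/andP; split.
    apply/subsetP=> y /setUP[yC|/setD1P[yt yT]]; rewrite inE.
      by rewrite adj_sym CTadj.
    by rewrite adjT // eq_sym.
  rewrite -[#|nbr t|]/(degree t) degT // cardsU.
  have -> : C :&: (T :\ t) = set0.
    apply/setP=> y; rewrite !in_setI in_setD1 in_set0; apply/negP.
    by case/and3P=> /CT/negbTE->.
  by have := cardsD1 t T; rewrite tT T3 C2 cards0; clear; lia.
(* T and C cover at most five of at least six vertices, so connectedness demands an edge leaving
   them; neither T nor C has one. *)
have [|| y [z [yS]]] := @exit_edge G (T :|: C) Gc.
- by apply/set0Pn; exists a; rewrite !inE eqxx.
- rewrite -card_gt0; have := cardsC (T :|: C).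
  by have [+ _] := leq_card_setU T C; rewrite T3 C2; lia.
rewrite in_setU negb_or => /andP[zT zC] yz.
case/setUP: yS => yS.
  have : z \in nbr y by rewrite inE.
  by rewrite Tnbr // in_setU in_setD1 (negbTE zT) (negbTE zC) andbF.
have := Cadj _ _ yS yz; rewrite (negbTE (CT _ yS)) (negbTE zT) (negbTE zC).
by move=> /(_ erefl).
Qed.

Section Persistence.
Variables (G : sgraph) (k : nat).
Hypotheses (k4 : 4 <= k) (reg : regular G k) (sup : super_lambda 2 G).

Let G6 : 6 <= #|G|. Proof. exact: super_card sup. Qed.

Let deg := regular_degree reg.

Lemma super_persists m : 2 * k - 3 + m <= xi 2 G ->
    m = k - 1 \/ m = k - 3 /\ 5 <= k ->
  [/\ super_lambda 1 G, persists G m & m <= persistence G].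
Proof.
move=> xi_ge m_eq.
have pm : persists G m.
  apply/forallP=> F; apply/implyP=> /andP[FG Fm].
  exact: (@del_super G k m F).
split=> //; last first.
  apply: persistence_max => //.
  have : m < k by clear -k4 m_eq; lia.
  by have := regular_edges reg; have := G6; clear; nia.
(* G itself is the case of no deleted edges; destructing it makes it literally the [SGraph] in the
   conclusion of [del_super]. *)
clear pm deg G6; move: G reg sup xi_ge => [V a a_sym a_irr] reg' sup' xi'.
apply: (@del_super (SGraph a_sym a_irr) k m set0) => //.
- by move=> x y; rewrite /del_adj in_set0 andbT.
- exact: sub0set.
- by rewrite cards0.
Qed.

Lemma persists_lt_degree m : persists G m -> m < k.
Proof.
move=> /forallP pm; have /card_gt0P[x _] : 0 < #|G| by apply: leq_trans G6.
rewrite ltnNge; apply/negP=> km.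
have := implyP (pm (star x)); rewrite card_star deg km andbT.
have -> : star x \subset edges G by apply/subsetP=> f; rewrite inE => /andP[].
move=> /(_ isT) /super_connected Hc.
have [|y] := @nonisolated (del_edges (star x)) x Hc; first exact: leq_trans G6.
by rewrite /= /del_adj => /andP[xy]; rewrite inE mem_edges xy set21.
Qed.

(** A matching lowers each degree by at most one, so all degrees stay at least 4 and those of a, b,
    c become 4. The triangle survives because each deleted edge has an end among a', b', c'. *)
Lemma matching_breaks (a b c a' b' c' : G) : k = 5 ->
    adj a b -> adj a c -> adj b c -> adj a a' -> adj b b' -> adj c c' ->
    uniq [:: a; b; c; a'; b'; c'] ->
  ~~ super_lambda 1 (del_edges [set [set a; a']; [set b; b']; [set c; c']]).
Proof.
move=> k5 ab ac bc aa' bb' cc' un; set F := [set _; _; _].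
have matching (x y z : G) : [set x; y] \in F -> [set x; z] \in F -> y = z.
  rewrite !inE -!orbA.
  case/or3P=> /eqP/set2_inj[] [? ?]; case/or3P=> /eqP/set2_inj[] [? ?];
  subst=> //; by move: un; rewrite /= !inE !eqxx /= ?(orbT, andbF).
have degE (x : G) :
    @degree (del_edges F) x + #|[set y in nbr x | [set x; y] \in F]| = 5.
  by rewrite -k5 -(deg x) degree_del.
have le1 (x : G) : #|[set y in nbr x | [set x; y] \in F]| <= 1.
  apply/card_le1_eqP=> y z /setIdP[_ xy] /setIdP[_ xz].
  exact: (matching x).
have deg4 (x y : G) : adj x y -> [set x; y] \in F -> @degree (del_edges F) x = 4.
  move=> xy xyF; have : 0 < #|[set y in nbr x | [set x; y] \in F]|.
    by apply/card_gt0P; exists y; apply/setIdP; rewrite inE.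
  by move: (le1 x) (degE x); clear; lia.
have keep (x y : G) : x \in [:: a; b; c] -> y \in [:: a; b; c] -> adj x y ->
    @adj (del_edges F) x y.
  move=> xT yT xy; rewrite /= /del_adj xy /=.
  apply/negP=> xyF.
  have [w wout wxy] : exists2 w, w \in [:: a'; b'; c'] & w \in [set x; y].
    by move: xyF; rewrite !inE -!orbA => /or3P[] /eqP->;
      [exists a' | exists b' | exists c']; rewrite ?set22 // !inE eqxx ?orbT.
  move: un; rewrite -[_ :: _]/([:: a; b; c] ++ [:: a'; b'; c']) cat_uniq.
  case/and3P=> _ /hasPn/(_ w wout)/= + _.
  by case/set2P: wxy => ->; rewrite ?xT ?yT.
apply: (@triangle_not_super (del_edges F) a b c).
- exact: G6.
- by move=> x; move: (le1 x) (degE x); clear; lia.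
- by apply: keep; rewrite ?inE ?eqxx ?orbT.
- by apply: keep; rewrite ?inE ?eqxx ?orbT.
- by apply: keep; rewrite ?inE ?eqxx ?orbT.
- by apply: deg4 aa' _; rewrite !inE eqxx.
- by apply: deg4 bb' _; rewrite !inE eqxx orbT.
- by apply: deg4 cc' _; rewrite !inE eqxx orbT.
Qed.

Lemma persists_le2 (a b c : G) m : k = 5 -> adj a b -> adj a c -> adj b c ->
  persists G m -> m <= 2.
Proof.
move=> k5 ab ac bc /forallP pm; rewrite leqNgt; apply/negP=> m3.
(* Besides x the list has at most four vertices, so one of the five neighbours of x is outside. This
   lets a', b', c' be chosen greedily. *)
have out (x : G) (s : seq G) : size s <= 5 -> x \in s ->
    exists2 w, adj x w & w \notin s.
  move=> s5 xs; have : ~~ (nbr x \subset [set y in s] :\ x).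
    apply/negP=> /subset_leq_card; rewrite -[#|nbr x|]/(degree x) deg k5.
    have := cardsD1 x [set y in s]; rewrite inE xs.
    have : #|[set y in s]| <= size s by rewrite cardsE card_size.
    by move: s5; clear; lia.
  case/subsetPn=> w; rewrite !inE => xw.
  by rewrite eq_sym adj_neq //; exists w.
have [a' aa' na'] := out a [:: a; b; c] isT (mem_head _ _).
have [||b' bb' nb'] := out b [:: a; b; c; a'] => //.
  by rewrite !inE eqxx orbT.
have [||c' cc' nc'] := out c [:: a; b; c; a'; b'] => //.
  by rewrite !inE eqxx !orbT.
have un : uniq [:: a; b; c; a'; b'; c'].
  rewrite -[[:: a, b, c, a', b' & _]]/(rcons [:: a; b; c; a'; b'] c').
  rewrite rcons_uniq nc' -[[:: a, b, c, a' & _]]/(rcons [:: a; b; c; a'] b').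
  rewrite rcons_uniq nb' -[[:: a, b, c & _]]/(rcons [:: a; b; c] a').
  by rewrite rcons_uniq na' /= !inE negb_or !adj_neq.
have /negP[] := matching_breaks k5 ab ac bc aa' bb' cc' un.
apply: (implyP (pm _)); apply/andP; split.
  by apply/subsetP=> f; rewrite !inE => /orP[/orP[]|] /eqP->; rewrite mem_edges.
apply: leq_trans m3; apply: leq_trans (leq_card_setU _ _) _.
by rewrite cards1 cards2; case: eqP.
Qed.

End Persistence.

Theorem theorem3p8 (G : sgraph) (k : nat)
    (hk : 4 <= k) (hreg : regular G k) (hsuper : super_lambda 2 G) :
  (4 <= girth G -> persistence_eq G (k - 1)) /\
  (girth G = 3 ->
     (6 <= k -> persistence_ge G (k - 3)) /\
     (k = 5 -> persistence_eq G 2)).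
Proof.
have G6 : 6 <= #|G| := super_card hsuper.
have G3 : 3 <= #|G| by apply: leq_trans G6.
split=> [g4|g3].
  have [||sup1 _ ge] := @super_persists G k hk hreg hsuper (k - 1).
  - apply: leq_trans (regular_xi2_ge hreg hk G6 (isT : 2 <= 3) _); first by lia.
    by move=> a b c _ _ _; apply: girth_gt3.
  - by left.
  split=> //; apply/eqP; rewrite eqn_leq ge andbT.
  by apply: persistence_le => m /(persists_lt_degree hreg hsuper); lia.
(* This serves both claims for girth 3: at k = 5 the bound k - 3 equals 2. *)
have low : 5 <= k -> persistence_ge G (k - 3).
  move=> k5; have [||sup1 _ ge] := @super_persists G k hk hreg hsuper (k - 3).
  - apply: leq_trans (regular_xi2_ge hreg hk G6 (isT : 3 <= 3) _); first by lia.
    by move=> a b c _ _ _; case: adj; case: adj; case: adj.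
  - by right.
  by [].
split=> [k6|k5]; first by apply: low; lia.
have [|sup1 ge] := low; first by rewrite k5.
split=> //; apply/eqP; rewrite eqn_leq; apply/andP; split; last first.
  by move: ge; rewrite k5.
have [a [b [c [ab ac bc]]]] := girth3_triangle G3 g3.
apply: persistence_le => m.
exact: (persists_le2 hk hreg hsuper k5 ab ac bc).
Qed.
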